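(* Suppose that there exists a semi-metric $\rho$ on $\mathcal F$ such that $\mathcal F$ is totally bounded with respect to $\rho$ and $$\lim_{\delta\downarrow 0}\limsup_{n\to\infty}\sup_{f,g\in\mathcal F,\ \rho(f,g)<\delta}\frac1{r_nv_n}E\big(f(Y_n)-g(Y_n)\big)^2=0.$$ Suppose further that for all $l\in\mathbb N$ and all $f_1,\dots,f_l\in\mathcal F$ $$\sup_{g\in BL_1(\mathbb R^l)}\Big|E_\xi g\big((Z_{n,\xi}(f_k))_{1\le k\le l}\big)-Eg\big((Z(f_k))_{1\le k\le l}\big)\Big|\longrightarrow 0\quad\text{in probability},$$ and that $Z_{n,\xi}$ converges weakly to $Z$ in $\ell^\infty(\mathcal F)$. Then $$\sup_{g\in BL_1(\ell^\infty(\mathcal F))}\big|E_\xi g(Z_{n,\xi})-Eg(Z)\big|\longrightarrow 0\quad\text{in outer probability}.$$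
   Context: Let $E=\mathbb R^d$ and $E_\cup:=\bigcup_{l\in\mathbb N}E^l$, equipped with the $\sigma$-field induced by the Borel $\sigma$-fields on the $E^l$. A cluster functional is a measurable function $f:E_\cup\to\mathbb R$ with $f(0)=0$ and $f(y_1,\dots,y_l)=f(0,\dots,0,y_1,\dots,y_l,0,\dots,0)$ for all $(y_1,\dots,y_l)\in E_\cup$ and arbitrary numbers of zeros at the beginning and at the end. $\mathcal F$ is a family of cluster functionals and $\ell^\infty(\mathcal F)$ is the space of bounded real functions on $\mathcal F$ with norm $\|z\|_{\mathcal F}=\sup_{f\in\mathcal F}|z(f)|$. $(X_{n,i})_{1\le i\le n,\,n\in\mathbb N}$ is a row-wise stationary triangular array of $E$-valued random vectors, $v_n:=P\{X_{n,1}\ne 0\}>0$, $(r_n)$ is a sequence of positive integers, $m_n:=\lfloor n/r_n\rfloor$, $Y_{n,j}:=(X_{n,i})_{(j-1)r_n<i\le jr_n}$ for $1\le j\le m_n$, and $Y_n$ is a generic random vector distributed as $Y_{n,1}$. The multipliers $\xi_j$, $j\in\mathbb N$, are i.i.d. real random variables with $E(\xi_j)=0$, $Var(\xi_j)=1$, independent of the array $(X_{n,i})$. Define $$Z_{n,\xi}(f):=\frac1{\sqrt{nv_n}}\sum_{j=1}^{m_n}\xi_j\big(f(Y_{n,j})-Ef(Y_{n,j})\big),\quad f\in\mathcal F.$$ $Z$ is a centered Gaussian process indexed by $\mathcal F$ with covariance function $c(f,g)=\lim_{n\to\infty}\frac1{r_nv_n}Cov(f(Y_n),g(Y_n))$,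 $f,g\in\mathcal F$. $E_\xi$ denotes the (outer, where necessary) expectation with respect to $(\xi_j)_{j\in\mathbb N}$ only, i.e. conditionally on the data $X_{n,1},\dots,X_{n,n}$. $BL_1(\mathbb R^l)$ is the set of $g:\mathbb R^l\to\mathbb R$ with $\sup|g|\le1$ and $|g(v_1)-g(v_2)|\le\|v_1-v_2\|$ (maximum norm); $BL_1(\ell^\infty(\mathcal F))$ is the set of $g:\ell^\infty(\mathcal F)\to\mathbb R$ with $\sup|g|\le1$ and $|g(z_1)-g(z_2)|\le\|z_1-z_2\|_{\mathcal F}$. Weak convergence in $\ell^\infty(\mathcal F)$ is in the sense of Hoffmann-J\o rgensen (via outer expectations, with tight Borel measurable limit). *)

(* Defs.v *)
From HB Require Import structures.
From mathcomp Require Import all_boot all_order all_algebra.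
From mathcomp Require Import all_classical all_reals all_analysis.
From mathcomp Require Import measurable_realfun.

Set Implicit Arguments.
Unset Strict Implicit.
Unset Printing Implicit Defensive.

Import Order.TTheory GRing.Theory Num.Theory.
Import numFieldNormedType.Exports.

Local Open Scope classical_set_scope.
Local Open Scope ring_scope.

Definition borel (T : ptopologicalType) : Type := g_sigma_algebraType (@open T).
HB.instance Definition _ (T : ptopologicalType) := Measurable.on (borel T).

Section bounded_functions.
Variables (R : realType) (T : Type).

Definition bounded_functions : {pred T -> R} :=
  mem [set z : T -> R | exists M, forall t, `|z t| <= M].

Record linf := Linf {
  linf_fun :> T -> R;
  linf_bounded : linf_fun \in bounded_functions }.

HB.instance Definition _ := [isSub for linf_fun].
HB.instance Definition _ := gen_eqMixin linf.
HB.instance Definition _ := gen_choiceMixin linf.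

Lemma bounded_functions_submod_closed : submod_closed bounded_functions.
Proof.
split=> [|a u v]; first by apply/mem_set; exists 0 => t; rewrite normr0.
move=> /set_mem[M uM] /set_mem[N vN]; apply/mem_set; exists (`|a| * M + N) => t.
by rewrite (le_trans (ler_normD _ _))// lerD// normrM ler_wpM2l.
Qed.

HB.instance Definition _ :=
  GRing.isSubmodClosed.Build R (T -> R) bounded_functions
    bounded_functions_submod_closed.
HB.instance Definition _ := [SubChoice_isSubLmodule of linf by <:].

Definition linf_norm (z : linf) : R := sup (range (fun t => `|z t|)).

Lemma linf_norm_ub (z : linf) t : `|z t| <= linf_norm z.
Proof.
apply: ub_le_sup; last by exists t.
by have /set_mem[M zM] := linf_bounded z; exists M => _ [s _ <-].
Qed.

Lemma linf_norm_le (z : linf) M : 0 <= M -> (forall t, `|z t| <= M) -> linf_norm z <= M.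
Proof.
move=> M0 zM; have [[x rx]|/set0P/negP/negPn/eqP z0] :=
    pselect (range (fun t => `|z t|) !=set0).
  by apply: ge_sup; [exists x|move=> _ [t _ <-]].
by rewrite /linf_norm z0 sup0.
Qed.

Lemma linf_norm_ge0 (z : linf) : 0 <= linf_norm z.
Proof.
have [[_ [t _ _]]|/set0P/negP/negPn/eqP z0] :=
    pselect (range (fun t => `|z t|) !=set0).
  exact: le_trans (linf_norm_ub z t).
by rewrite /linf_norm z0 sup0.
Qed.

Let linf_normD (x y : linf) : linf_norm (x + y) <= linf_norm x + linf_norm y.
Proof.
apply: linf_norm_le; first by rewrite addr_ge0// linf_norm_ge0.
by move=> t; rewrite (le_trans (ler_normD _ _))// lerD// linf_norm_ub.
Qed.

Let linf_normZ a (x : linf) : linf_norm (a *: x) = `|a| * linf_norm x.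
Proof.
have le_normZ b z : linf_norm (b *: z) <= `|b| * linf_norm z.
  apply: linf_norm_le; first by rewrite mulr_ge0// linf_norm_ge0.
  by move=> t; rewrite normrM ler_wpM2l// linf_norm_ub.
apply/eqP; rewrite eq_le le_normZ/=.
have [->|a0] := eqVneq a 0; first by rewrite normr0 mul0r linf_norm_ge0.
rewrite -ler_pdivlMl ?normr_gt0// -normfV.
by rewrite -[x in X in X <= _](scalerK a0).
Qed.

Let linf_norm0_eq0 (x : linf) : linf_norm x = 0 -> x = 0.
Proof.
move=> x0; apply/val_inj/funext => t /=; apply/eqP.
by rewrite -normr_le0 -x0 linf_norm_ub.
Qed.

HB.instance Definition _ :=
  Lmodule_isNormed.Build R linf linf_normD linf_normZ linf_norm0_eq0.

End bounded_functions.

Section cluster_functionals.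
Variables (R : realType) (d : nat).

(* An element of E^l, for E = R^d, is an l x d matrix whose rows are its l
   components; the space is the disjoint union over l, including l = 0, where
   padding with zeros forces every cluster functional to vanish. *)
Definition Ecup : Type := {l : nat & 'M[R]_(l, d)}.

Definition mkEcup l (y : 'M[R]_(l, d)) : Ecup := existT _ l y.

Definition Ecup_measurable : set (set Ecup) :=
  [set A | forall l, measurable (@mkEcup l @^-1` A : set (borel 'M[R]_(l, d)))].

Let Ecup_measurable0 : Ecup_measurable set0.
Proof. by move=> l; rewrite preimage_set0; exact: measurable0. Qed.

Let Ecup_measurableC A : Ecup_measurable A -> Ecup_measurable (~` A).
Proof. by move=> mA l; rewrite preimage_setC; apply: measurableC; exact: mA. Qed.

Let Ecup_measurable_bigcup (A : (set Ecup)^nat) :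
  (forall i, Ecup_measurable (A i)) -> Ecup_measurable (\bigcup_i A i).
Proof.
by move=> mA l; rewrite preimage_bigcup; apply: bigcupT_measurable => i; exact: mA.
Qed.

Definition Ecup_display : measure_display. Proof. by constructor. Qed.

HB.instance Definition _ := gen_eqMixin Ecup.
HB.instance Definition _ := gen_choiceMixin Ecup.
HB.instance Definition _ := isPointed.Build Ecup (mkEcup (0 : 'M[R]_(1, d))).
HB.instance Definition _ := @isMeasurable.Build Ecup_display Ecup
  Ecup_measurable Ecup_measurable0 Ecup_measurableC Ecup_measurable_bigcup.

Definition cluster_functional : set (Ecup -> R) :=
  [set f : Ecup -> R | [/\ measurable_fun [set: Ecup] f,
     f (mkEcup (0 : 'M[R]_(1, d))) = 0 &
     forall l (y : 'M[R]_(l, d)) (a b : nat),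
       f (mkEcup (col_mx (0 : 'M[R]_(a, d)) (col_mx y (0 : 'M[R]_(b, d))))) =
       f (mkEcup y)]].

End cluster_functionals.

Section outer_integrals.
Local Open Scope ereal_scope.
Context d (T : measurableType d) (R : realType).

Definition integral_exists (mu : {measure set T -> \bar R}) (U : T -> \bar R) :=
  \int[mu]_x U^\+ x < +oo \/ \int[mu]_x U^\- x < +oo.

Definition outer_expectation (mu : {measure set T -> \bar R})
    (H : T -> \bar R) : \bar R :=
  ereal_inf [set \int[mu]_x U x | U in [set U : T -> \bar R |
    [/\ measurable_fun [set: T] U, integral_exists mu U &
        forall x, H x <= U x]]].

Definition outer_probability (mu : {measure set T -> \bar R}) (A : set T) :=
  ereal_inf [set mu B | B in [set B | measurable B /\ A `<=` B]].

End outer_integrals.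

Section weak_convergence.
Context (R : realType) (V : normedModType R).

Definition BL1 : set (V -> R) :=
  [set g | (forall v, `|g v| <= 1) /\
           (forall v1 v2, `|g v1 - g v2| <= `|v1 - v2|)].

Definition BL1_distance (L1 L2 : (V -> R) -> \bar R) : \bar R :=
  ereal_sup [set `|L1 g - L2 g|%E | g in BL1].

Definition tight d (T : measurableType d) (P : probability T R) (Z : T -> V) :=
  forall e : R, 0 < e ->
    exists2 K : set V, compact K & ((1 - e)%:E <= P (Z @^-1` K))%E.

(* Hoffmann-Jorgensen weak convergence to a tight Borel measurable limit. *)
Definition cvg_weakly d (T : measurableType d) (P : probability T R)
    (Zn : nat -> T -> V)
    d' (T' : measurableType d') (P' : probability T' R) (Z : T' -> V) :=
  [/\ measurable_fun [set: T'] (Z : T' -> borel V),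
      tight P' Z &
      forall h : V -> R, continuous h -> (exists M, forall v, `|h v| <= M) ->
        (fun n => outer_expectation P (fun w => (h (Zn n w))%:E)) @ \oo -->
        'E_P'[h \o Z]%E].

End weak_convergence.

Section gaussian.
Variable R : realType.

(* [normal_prob m 0] is the uniform law on [0, 1], not the Dirac measure at m,
   whence the case distinction for degenerate normal laws. *)
Definition normal_law (m s : R) (B : set R) : \bar R :=
  if s == 0 then \d_m B else normal_prob m s B.

Definition gaussian_process d (T : measurableType d) (P : probability T R)
    (I : Type) (Z : I -> T -> R) :=
  forall l (t : 'I_l -> I) (a : 'I_l -> R), exists m s, forall B : set R,
    measurable B ->
    P ((fun w => \sum_(k < l) a k * Z (t k) w) @^-1` B) = normal_law m s B.

Definition centered_gaussian_process d (T : measurableType d)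
    (P : probability T R) (I : Type) (Z : I -> T -> R) (c : I -> I -> R) :=
  [/\ gaussian_process P Z,
      forall f, 'E_P[Z f]%E = 0%E &
      forall f g, covariance P (Z f) (Z g) = (c f g)%:E].

End gaussian.

Section families.
Context (R : realType) d (T : measurableType d) (P : probability T R).

Definition mutually_independent (X : nat -> T -> R) :=
  forall (J : seq nat) (B : nat -> set R), uniq J ->
    (forall j, measurable (B j)) ->
    P (\bigcap_(j in [set` J]) (X j @^-1` B j)) =
    (\prod_(j <- J) P (X j @^-1` B j))%E.

Definition identically_distributed (X : nat -> T -> R) :=
  forall i j (B : set R), measurable B -> P (X i @^-1` B) = P (X j @^-1` B).

End families.

Section semimetric.
Context (R : realType) (I : Type).

Definition semimetric (rho : I -> I -> R) :=
  [/\ forall f g, 0 <= rho f g, forall f, rho f f = 0,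
      forall f g, rho f g = rho g f &
      forall f g h, rho f h <= rho f g + rho g h].

Definition totally_bounded_for (rho : I -> I -> R) :=
  forall e : R, 0 < e -> exists (l : nat) (t : 'I_l -> I),
    forall f, exists k, rho f (t k) < e.

End semimetric.

(* Indices start at 0: X n i is the (i+1)-st vector of the n-th row,
   clusterY X r n j is the (j+1)-st block, and xi j the (j+1)-st multiplier. *)
Section array.
Context (R : realType) (d : nat) dX (OX : measurableType dX)
  (PX : probability OX R).
Variable X : nat -> nat -> OX -> 'rV[R]_d.

Definition segment_of_row (n s l : nat) (w : OX) : 'M[R]_(l, d) :=
  \matrix_(i < l, k < d) X n (s + i)%N w 0 k.

Definition rowwise_stationary := forall n l s, (s + l <= n)%N ->
  forall A : set 'M[R]_(l, d), measurable (A : set (borel 'M[R]_(l, d))) ->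
    PX (segment_of_row n s l @^-1` A) = PX (segment_of_row n 0 l @^-1` A).

Definition nonzero_prob (n : nat) : R := fine (PX [set w | X n 0 w != 0]).

Variable r : nat -> nat.

Definition clusterY (n j : nat) (w : OX) : Ecup R d :=
  mkEcup (segment_of_row n (j * r n) (r n) w).

(* Data and multipliers live on the two factors of a product space, so that
   they are independent and the conditional (outer) expectation E_xi given the
   data is the (outer) integral over the second coordinate. *)
Definition multiplier_process dxi (Oxi : measurableType dxi)
    (xi : nat -> Oxi -> R) (n : nat) (w : OX * Oxi) (f : Ecup R d -> R) : R :=
  (Num.sqrt (n%:R * nonzero_prob n))^-1 *
  \sum_(j < n %/ r n) xi j w.2 *
    (f (clusterY n j w.1) - fine 'E_PX[f \o clusterY n j]).

End array.

(* Main.v *)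
Require Import Defs.
From HB Require Import structures.
From mathcomp Require Import all_boot all_order all_algebra.
From mathcomp Require Import all_classical all_reals all_analysis.
From mathcomp Require Import measurable_realfun.
From mathcomp Require Import lra.

Set Implicit Arguments.
Unset Strict Implicit.
Unset Printing Implicit Defensive.

Import Order.TTheory GRing.Theory Num.Theory.
Import numFieldNormedType.Exports.

Local Open Scope classical_set_scope.
Local Open Scope ring_scope.

(* A compact subset K of l^oo(F) carrying most of the mass of Z is totally
   bounded, hence up to a small error its elements are constant on the cells of
   one finite partition of F. With k f the cell of f and t a choice of
   representatives, z is compared with z o t o k through
   h(z) = min(2, |z - z o t o k|), for which E h(Z) is small. For g in BL1,
   each of E_xi g(Z_n) and E g(Z) changes by at most the (outer) expectation of
   h when its argument is replaced by its discretization, after which the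
   finite-dimensional hypothesis applies. By weak convergence the unconditional
   outer expectation of h(Z_n) is eventually small, so that h(Z_n) has a
   measurable majorant U with small integral; Tonelli and Markov bound the
   probability that E_xi U is large. Finally, the events in the
   finite-dimensional hypothesis have to be shown measurable, as otherwise
   their measure carries no information. *)

(** * Lipschitz maps, Borel measurability and finite nets in normed spaces *)

Lemma lipschitz_continuous (R : realType) (V W : normedModType R) (k : R)
    (f : V -> W) :
  0 < k -> (forall x y, `|f x - f y| <= k * `|x - y|) -> continuous f.
Proof.
move=> k0 fk x; apply/cvgrPdist_lt => e e0.
near=> y; apply: le_lt_trans (fk _ _) _.
rewrite -ltr_pdivlMl//; near: y.
by apply: cvgr_dist_lt; rewrite ?mulr_gt0 ?invr_gt0//; exact: cvg_id.
Unshelve. all: by end_near. Qed.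

Lemma BL1_continuous (R : realType) (V : normedModType R) (g : V -> R) :
  BL1 g -> continuous g.
Proof.
by case=> _ lg; apply: (@lipschitz_continuous _ _ _ 1) => // x y; rewrite mul1r.
Qed.

Lemma continuous_borel_measurable (R : realType) (V : normedModType R)
    d (T : measurableType d) (Z : T -> V) (f : V -> R) :
  measurable_fun [set: T] (Z : T -> borel V) -> continuous f ->
  measurable_fun [set: T] (f \o Z).
Proof.
move=> mZ cf; apply: (measurability _ (measurable_realfun.RGenOpens.measurableE R)).
move=> _ [_ [a [b ->]] <-]; rewrite comp_preimage; apply: mZ => //.
by apply: sub_sigma_algebra; move/continuousP: cf; apply; exact: interval_open.
Qed.

Lemma compact_ball_net (R : realType) (V : normedModType R) (K : set V) (e : R) :
  0 < e -> compact K -> exists s : seq V,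
    forall z, K z -> exists2 y, y \in s & `|z - y| < e.
Proof.
move=> e0; rewrite compact_cover => /(_ V K (fun y => ball y e)).
case=> [y _|z Kz|s _ Ks]; first exact: ball_open.
  by exists z => //; exact: ballxx.
exists (finmap.enum_fset s) => z /Ks[y /= ys]; rewrite -ball_normE /= distrC => ?.
by exists y.
Qed.

(** * Finite-rank discretization of bounded functions, uniformly on compact sets *)

Section finite_rank.
Variables (R : realType) (T : Type).
Implicit Types (z : linf R T).

(** Induction on the list: each new function refines the partition by a binning of its bounded range
    into finitely many intervals of length [e]. *)
Lemma finite_oscillation_partition (s : seq (linf R T)) (e : R) : 0 < e ->
  exists (I : finType) (k : T -> I), forall z, z \in s ->
    forall f g, k f = k g -> `|z f - z g| <= e.
Proof.
move=> e0; elim: s => [|z s [I [k IH]]]; first by exists unit, (fun=> tt).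
(* Adding the norm makes the quotient nonnegative, so that [Num.trunc] is its floor, and bounded by
   [2 * |z| / e]. *)
pose b f := Num.trunc ((z f + `|z|) / e).
have zn f : - `|z| <= z f <= `|z| by rewrite -ler_norml; exact: linf_norm_ub.
have q0 f : 0 <= (z f + `|z|) / e.
  by rewrite divr_ge0// ?(ltW e0)//; have /andP[] := zn f; lra.
have bN f : (b f < (Num.trunc (2 * `|z| / e)).+1)%N.
  rewrite ltnS; apply: le_truncn; rewrite ler_pM2r ?invr_gt0//.
  by have /andP[] := zn f; lra.
exists (I * 'I_(Num.trunc (2 * `|z| / e)).+1)%type, (fun f => (k f, Ordinal (bN f))).
move=> y; rewrite inE => /predU1P[->|ys] f g [kfg bfg]; last exact: IH.
have /andP[f1 f2] := truncn_itv (q0 f).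
have /andP[g1 g2] := truncn_itv (q0 g).
rewrite -/(b f) in f1 f2; rewrite -/(b g) -bfg in g1 g2.
rewrite ler_pdivlMr// in f1; rewrite ler_pdivlMr// in g1.
rewrite ltr_pdivrMr// in f2; rewrite ltr_pdivrMr// in g2.
rewrite -natr1 mulrDl mul1r in f2; rewrite -natr1 mulrDl mul1r in g2.
by rewrite ler_norml; apply/andP; split; lra.
Qed.

Definition sample l (t : 'I_l -> T) z : 'rV[R]_l := \row_i z (t i).

Lemma row_normE l (v : 'rV[R]_l) : `|v| = \big[Num.max/0]_ij `|v ij.1 ij.2|.
Proof. exact: mx_normrE. Qed.

Lemma row_norm_ub l (v : 'rV[R]_l) i : `|v 0 i| <= `|v|.
Proof. by rewrite row_normE (le_bigmax _ (fun ij => `|v ij.1 ij.2|) (0, i)). Qed.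

Lemma row_norm_le l (v : 'rV[R]_l) (M : R) :
  0 <= M -> (forall i, `|v 0 i| <= M) -> `|v| <= M.
Proof.
move=> M0 vM; rewrite row_normE; apply/bigmax_leP; split=> //= -[i j] _ /=.
by rewrite ord1.
Qed.

Lemma step_bounded l (k : T -> 'I_l) (v : 'rV[R]_l) :
  (fun f => v 0 (k f)) \in @bounded_functions R T.
Proof. by apply/mem_set; exists `|v| => f; exact: row_norm_ub. Qed.

Definition step l (k : T -> 'I_l) (v : 'rV[R]_l) : linf R T :=
  Linf (step_bounded k v).

Lemma le_norm_step l (k : T -> 'I_l) (v v' : 'rV[R]_l) :
  `|step k v - step k v'| <= `|v - v'|.
Proof.
apply: linf_norm_le => // f.
have -> : (step k v - step k v') f = (v - v') 0 (k f) by rewrite !mxE.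
exact: row_norm_ub.
Qed.

Lemma le_norm_sample l (t : 'I_l -> T) z z' :
  `|sample t z - sample t z'| <= `|z - z'|.
Proof.
apply: row_norm_le => // i; rewrite !mxE.
exact: (linf_norm_ub (z - z')).
Qed.

(** The level 2 is the largest possible difference between two values of a function in [BL1]; the
    truncation makes this an admissible test function for weak convergence. *)
Definition step_error l (t : 'I_l -> T) (k : T -> 'I_l) z : R :=
  Num.min 2 `|z - step k (sample t z)|.

Lemma step_error_ge0 l (t : 'I_l -> T) (k : T -> 'I_l) z :
  0 <= step_error t k z.
Proof. by rewrite le_min normr_ge0 andbT. Qed.

Lemma step_error_le2 l (t : 'I_l -> T) (k : T -> 'I_l) z :
  step_error t k z <= 2.
Proof. by rewrite ge_min lexx. Qed.

(** Lipschitz with constant 2: the argument and its discretization each contribute 1, and truncation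
    does not increase differences. *)
Lemma step_error_continuous l (t : 'I_l -> T) (k : T -> 'I_l) :
  continuous (step_error t k).
Proof.
apply: (@lipschitz_continuous _ _ _ 2) => // x y.
pose a := x - step k (sample t x); pose b := y - step k (sample t y).
have ab : `| `|a| - `|b| | <= 2 * `|x - y|.
  apply: le_trans (ler_dist_dist _ _) _.
  have -> : a - b = (x - y) - (step k (sample t x) - step k (sample t y)).
    by rewrite /a /b !opprB addrACA [RHS]addrACA (addrC (- y)).
  rewrite mulr_natl mulr2n; apply: le_trans (ler_normB _ _) _; rewrite lerD2l.
  exact: le_trans (le_norm_step _ _ _) (le_norm_sample _ _ _).
move: ab; rewrite /step_error -/a -/b !ler_norml => /andP[ab1 ab2].
by apply/andP; split; rewrite /Num.min; case: ifP => ?; case: ifP => ?; lra.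
Qed.

Lemma compact_step_error (K : set (linf R T)) (e : R) : 0 < e -> compact K ->
  exists l (t : 'I_l -> T) (k : T -> 'I_l), forall z, K z -> step_error t k z <= e.
Proof.
move=> e0 cK; have e3 : 0 < e / 3 by lra.
have [s Ks] := compact_ball_net e3 cK.
have [I [k0 k0s]] := finite_oscillation_partition s e3.
(* An empty index set has no representatives; there [l = 0] works, since every norm vanishes. *)
have [[f0 _]|T0] := pselect (exists f : T, True); last first.
  have F0 (f : T) : False by apply: T0; exists f.
  have t0 : 'I_0 -> T by case.
  have k1 : T -> 'I_0 by move=> f; case: (F0 f).
  exists 0%N, t0, k1.
  move=> z _; rewrite ge_min; apply/orP; right.
  by apply: linf_norm_le => [|f]; [exact: ltW|have := F0 f].
(* [t0 i] represents the cell [i]; on empty cells, which contain no index to be compared, it takes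
   the default value [f0]. *)
have /choice[t0 t0P] i : exists f, (exists g, k0 g = i) -> k0 f = i.
  have [[g gi]|ni] := pselect (exists g, k0 g = i); first by exists g.
  by exists f0.
exists #|I|, (fun i => t0 (enum_val i)), (fun f => enum_rank (k0 f)) => z Kz.
rewrite ge_min; apply/orP; right.
apply: linf_norm_le => [|f]; first exact: ltW.
have -> : (z - step (fun f => enum_rank (k0 f))
    (sample (fun i => t0 (enum_val i)) z)) f = z f - z (t0 (k0 f)).
  by congr (z f - _); rewrite /= mxE enum_rankK.
(* One third of [e] each for replacing [z] by the net point [y] at [f], the oscillation of [y] on
   the cell, and the return to [z] at the representative. *)
have [y ys zy] := Ks _ Kz.
have := k0s _ ys f (t0 (k0 f)); rewrite t0P; last by exists f.
move=> /(_ erefl); have zyP g : `|z g - y g| <= e / 3.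
  exact: le_trans (linf_norm_ub (z - y) g) (ltW zy).
have := zyP f; have := zyP (t0 (k0 f)).
by rewrite !ler_norml /= => /andP[? ?] /andP[? ?] /andP[? ?]; apply/andP; split; lra.
Qed.

End finite_rank.

(** * A countable class of Lipschitz functions approximating [BL1] on row vectors *)

Section cones.
Variables (R : realType) (l : nat).
Implicit Types (v : 'rV[R]_l) (s : seq ('rV[rat]_l * rat)).

(** A finite version of the McShane formula [g v = inf_q (g q + |v - q|)], valid for 1-Lipschitz
    [g]; a pair in [s] holds the apex [q] and the height. Starting the minimum at 1 gives the upper
    truncation. *)
Definition min_cone s v : R :=
  \big[Num.min/1]_(p <- s) (ratr p.2 + `|v - map_mx ratr p.1|).

(* Truncations to [-1, 1] of minima of finitely many cones with rational
   apexes: a countable class, pointwise sequentially dense in BL1. *)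
Definition cone_fun s v : R := Num.max (-1) (min_cone s v).

Lemma min_cone_cons p s v : min_cone (p :: s) v =
  Num.min (ratr p.2 + `|v - map_mx ratr p.1|) (min_cone s v).
Proof. exact: big_cons. Qed.

Lemma min_cone_le1 s v : min_cone s v <= 1.
Proof. exact: bigmin_le_id. Qed.

Lemma min_cone_le s v p :
  p \in s -> min_cone s v <= ratr p.2 + `|v - map_mx ratr p.1|.
Proof.
elim: s => // q s IH; rewrite inE min_cone_cons ge_min.
by case/predU1P => [->|/IH ->]; rewrite ?lexx ?orbT.
Qed.

Lemma min_cone_ge s v (m : R) : m <= 1 ->
  (forall p, p \in s -> m <= ratr p.2 + `|v - map_mx ratr p.1|) ->
  m <= min_cone s v.
Proof.
move=> m1; elim: s => [_|q s IH ms]; first by rewrite /min_cone big_nil.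
rewrite min_cone_cons le_min ms ?mem_head//= IH// => p ps.
by rewrite ms// inE ps orbT.
Qed.

Lemma BL1_cone_fun s : BL1 (cone_fun s).
Proof.
split=> [v|v w].
  rewrite ler_norml le_max lexx/= ge_max min_cone_le1 andbT; lra.
have : `|min_cone s v - min_cone s w| <= `|v - w|.
  elim: s => [|p s IH]; first by rewrite /min_cone !big_nil subrr normr0.
  rewrite !min_cone_cons.
  have := ler_dist_dist (v - map_mx ratr p.1) (w - map_mx ratr p.1).
  rewrite opprB addrA subrK; move: IH; rewrite !ler_norml.
  move=> /andP[? ?] /andP[? ?]; apply/andP.
  by split; rewrite /Num.min; case: ifP => ?; case: ifP => ?; lra.
rewrite /cone_fun !ler_norml => /andP[? ?]; apply/andP.
by split; rewrite /Num.max; case: ifP => ?; case: ifP => ?; lra.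
Qed.

Lemma rat_row_dense v (e : R) : 0 < e ->
  exists q : 'rV[rat]_l, `|v - map_mx ratr q| <= e.
Proof.
move=> e0; have /choice[q qP] i : exists q : rat, `|v 0 i - ratr q| <= e.
  have [|q] := @rat_in_itvoo R (v 0 i - e) (v 0 i + e); first by lra.
  rewrite in_itv /= => /andP[? ?]; exists q.
  by rewrite ler_norml; apply/andP; split; lra.
exists (\row_i q i); apply: row_norm_le => [|i]; first exact: ltW.
by rewrite !mxE.
Qed.

(** The n-th list uses the first [n] rational apexes, with heights exceeding [g] there by at most
    [1 / (n + 1)]. Heights above [g] keep the minimum above [g], by the Lipschitz property; an apex
    close to [v], once listed, bounds it from above. *)
Lemma BL1_cone_approx (g : 'rV[R]_l -> R) : BL1 g ->
  exists s : nat -> seq ('rV[rat]_l * rat), forall v,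
    cone_fun (s n) v @[n --> \oo] --> g v.
Proof.
case=> g1 gL.
have /choice[a aP] (nq : nat * 'rV[rat]_l) : exists a : rat,
    g (map_mx ratr nq.2) <= ratr a <= g (map_mx ratr nq.2) + nq.1.+1%:R^-1.
  case: nq => n q /=.
  have [|a] := @rat_in_itvoo R (g (map_mx ratr q)) (g (map_mx ratr q) + n.+1%:R^-1).
    by rewrite ltrDl invr_gt0.
  by rewrite in_itv /= => /andP[/ltW ? /ltW ?]; exists a; apply/andP.
(* An enumeration of all rational rows; codes that decode to nothing give the row 0. *)
pose q i : 'rV[rat]_l := odflt 0 (unpickle i).
exists (fun n => [seq (q i, a (n, q i)) | i <- iota 0 n]) => v.
apply/cvgrPdist_le => e e0.
have e3 : 0 < e / 3 by lra.
have [q0 q0v] := rat_row_dense v e3.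
near=> n.
have gn : g v <= min_cone [seq (q i, a (n, q i)) | i <- iota 0 n] v.
  apply: min_cone_ge => [|p /mapP[i _ ->] /=].
    by apply: le_trans (g1 v); exact: ler_norm.
  have /= /andP[aq _] := aP (n, q i).
  have := gL v (map_mx ratr (q i)); rewrite ler_norml => /andP[_ ?]; lra.
have gn' : min_cone [seq (q i, a (n, q i)) | i <- iota 0 n] v <= g v + e.
  have q0n : (q0, a (n, q0)) \in [seq (q i, a (n, q i)) | i <- iota 0 n].
    apply/mapP; exists (pickle q0); last by rewrite /q pickleK.
    by rewrite mem_iota /= add0n; near: n; exact: nbhs_infty_gt.
  apply: le_trans (min_cone_le v q0n) _ => /=.
  have /= /andP[_ aq] := aP (n, q0).
  have : n.+1%:R^-1 <= e / 3.
    by apply: ltW; near: n; exact: (near_infty_natSinv_lt (PosNum e3)).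
  have := gL v (map_mx ratr q0); rewrite ler_norml => /andP[gq _].
  by move: (n.+1%:R^-1) aq => x aq ?; lra.
(* The lower truncation is harmless because [g v] is at least -1. *)
have := g1 v; rewrite ler_norml => /andP[? ?].
rewrite /cone_fun ler_norml.
by apply/andP; split; rewrite /Num.max; case: ifP => ?; lra.
Unshelve. all: by end_near. Qed.

Lemma cone_fun_measurable d (T : measurableType d) (a : T -> 'rV[R]_l) s :
  (forall i, measurable_fun [set: T] (fun w => a w 0 i)) ->
  measurable_fun [set: T] (fun w => cone_fun s (a w)).
Proof.
move=> ma; apply: measurable_maxr => //.
elim: s => [|p s IH].
  by under eq_fun do rewrite /min_cone big_nil; exact: measurable_cst.
under eq_fun do rewrite min_cone_cons.
apply: measurable_minr => //; apply: measurable_funD => //.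
under eq_fun do rewrite row_normE.
elim: (index_enum _) => [|ij r IHr].
  by under eq_fun do rewrite big_nil; exact: measurable_cst.
under eq_fun do rewrite big_cons.
apply: measurable_maxr => //; apply: measurableT_comp => //.
under eq_fun do rewrite !mxE (ord1 ij.1).
exact: measurable_funB.
Qed.

(** Measurability passes to the pointwise limit of the [cone_fun]s, which are built from the
    coordinates by finitely many lattice and arithmetic operations. *)
Lemma BL1_measurable d (T : measurableType d) (a : T -> 'rV[R]_l) g :
  BL1 g -> (forall i, measurable_fun [set: T] (fun w => a w 0 i)) ->
  measurable_fun [set: T] (fun w => g (a w)).
Proof.
move=> /BL1_cone_approx[s sg] ma.
apply: (@measurable_fun_cvg _ _ _ _ (fun n w => cone_fun (s n) (a w))) => // n.
exact: cone_fun_measurable.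
Qed.

End cones.

(** * Expectations of [BL1] functions and measurability of the finite-dimensional distance *)

Lemma bounded_integrable (R : realType) d (T : measurableType d)
    (P : probability T R) (f : T -> R) (M : R) :
  measurable_fun [set: T] f -> (forall x, `|f x| <= M) ->
  P.-integrable [set: T] (fun x => (f x)%:E).
Proof.
move=> mf fM; apply: measurable_bounded_integrable => //.
  by rewrite (le_lt_trans (probability_le1 _ _)) ?ltry.
by exists M; split=> [|y My x _ /=]; [exact: num_real|exact: le_trans (fM x) (ltW My)].
Qed.

Lemma BL1_expectation_cvg (R : realType) l d (T : measurableType d)
    (P : probability T R) (a : T -> 'rV[R]_l) g (s : nat -> seq ('rV[rat]_l * rat)) :
  BL1 g -> (forall i, measurable_fun [set: T] (fun w => a w 0 i)) ->
  (forall v, cone_fun (s n) v @[n --> \oo] --> g v) ->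
  'E_P[fun w => cone_fun (s n) (a w)]%E @[n --> \oo] --> 'E_P[fun w => g (a w)]%E.
Proof.
move=> bg ma sg; under eq_fun do rewrite unlock; rewrite unlock.
apply: (@dominated_cvg _ _ _ _ _ _ _ _ (cst 1%E)) => //.
- by move=> n; apply/measurable_EFinP; exact: cone_fun_measurable.
- by move=> x _; apply: cvg_EFin; [exact: nearW|exact: sg].
- by apply: (@bounded_integrable _ _ _ _ (cst 1) 1) => // x; rewrite normr1.
- by move=> n x _ /=; rewrite lee_fin; have [+ _] := BL1_cone_fun R (s n); exact.
Qed.

Lemma BL1_expectation_fin_num (R : realType) l d (T : measurableType d)
    (P : probability T R) (a : T -> 'rV[R]_l) g :
  BL1 g -> (forall i, measurable_fun [set: T] (fun w => a w 0 i)) ->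
  'E_P[fun w => g (a w)]%E \is a fin_num.
Proof.
move=> bg ma; rewrite unlock; apply: integrable_fin_num => //.
apply: (@bounded_integrable _ _ _ _ _ 1); first exact: BL1_measurable.
by move=> x; case: bg.
Qed.

(* By dominated convergence, the supremum over BL1 is also one over the
   countable class of the [cone_fun]s. *)
Lemma BL1_distance_gt_measurable (R : realType) l
    d1 (T1 : measurableType d1) (P1 : probability T1 R)
    d2 (T2 : measurableType d2) (P2 : probability T2 R)
    (a : T1 * T2 -> 'rV[R]_l)
    d (T : measurableType d) (P : probability T R) (b : T -> 'rV[R]_l) (e : R) :
  (forall i, measurable_fun [set: T1 * T2] (fun w => a w 0 i)) ->
  (forall i, measurable_fun [set: T] (fun w => b w 0 i)) ->
  measurable [set w | (e%:E < BL1_distance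
    (fun g : 'rV[R]_l -> R => 'E_P2[fun w' => g (a (w, w'))])
    (fun g : 'rV[R]_l -> R => 'E_P[fun w' => g (b w')]))%E].
Proof.
move=> ma mb.
have ma2 w i : measurable_fun [set: T2] (fun w' => a (w, w') 0 i).
  exact: measurableT_comp (ma i) (pair1_measurable w).
rewrite (_ : [set _ | _] = \bigcup_(s in [set: seq ('rV[rat]_l * rat)])
    [set w | e%:E < `|'E_P2[fun w' => cone_fun s (a (w, w'))] -
                      'E_P[fun w' => cone_fun s (b w')]|]%E).
  apply: countable_bigcupT_measurable => // s; rewrite -[X in measurable X]setTI.
  apply: emeasurable_fun_o_infty => //; apply: measurableT_comp => //.
  apply: emeasurable_funB => //.
  (* For a fixed [cone_fun], Fubini's theorem makes the inner expectation measurable in [w]. *)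
  rewrite [X in measurable_fun _ X](_ : _ =
      fubini_F P2 (fun w => (cone_fun s (a w))%:E)).
    apply: (@measurable_fubini_F _ _ _ _ _ P1).
    apply: (@bounded_integrable _ _ _ (P1 \x P2)%E _ 1).
      exact: cone_fun_measurable.
    by move=> x; have [+ _] := BL1_cone_fun R s; exact.
  by apply/funext => w; rewrite unlock.
apply/seteqP; split=> w /=; last first.
  case=> s _ /= es; apply: lt_le_trans es _; apply: ereal_sup_ubound.
  by exists (cone_fun s) => //; exact: BL1_cone_fun.
move=> /ereal_sup_gt[_ [g bg <-]] eg.
have [s sg] := BL1_cone_approx bg.
have : (`|'E_P2[fun w' => cone_fun (s n) (a (w, w'))] -
     'E_P[fun w' => cone_fun (s n) (b w')]| @[n --> \oo] -->
   `|'E_P2[fun w' => g (a (w, w'))] - 'E_P[fun w' => g (b w')]|)%E.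
  apply: cvg_abse; apply: cvgeB.
  - by rewrite fin_num_adde_defl// fin_numN BL1_expectation_fin_num.
  - exact: BL1_expectation_cvg.
  - exact: BL1_expectation_cvg.
(* Exceeding [e] strictly is an open condition, so it already holds for some approximating
   [cone_fun]. *)
move=> /(_ _ (open_ereal_gt' eg)).
case=> N _ /(_ N (leqnn N)) eN.
by exists (s N).
Qed.

(** * Outer expectation, outer probability and Markov's inequality *)

Section outer_expectation_lemmas.
Context d (T : measurableType d) (R : realType).
Implicit Types (P : probability T R).
Local Open Scope ereal_scope.

(** Positive and negative parts are compared separately, which allows infinite integrals, as occur
    for majorants in an outer expectation. *)
Lemma le_integral_measurable P (f g : T -> \bar R) :
  measurable_fun [set: T] f -> measurable_fun [set: T] g ->
  (forall x, f x <= g x) -> \int[P]_x f x <= \int[P]_x g x.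
Proof.
move=> mf mg fg; rewrite integralE [leRHS]integralE; apply: leeB.
  apply: ge0_le_integral => //; try exact: measurable_funepos.
  by move=> x _; apply: (@funepos_le _ _ setT); rewrite ?inE.
apply: ge0_le_integral => //; try exact: measurable_funeneg.
by move=> x _; apply: (@funeneg_le _ _ setT); rewrite ?inE.
Qed.

Lemma integrable_integral_exists P (f : T -> \bar R) :
  P.-integrable [set: T] f -> integral_exists P f.
Proof. by move=> fi; left; exact: integral_funepos_lt_pinfty. Qed.

(** When [U] is integrable, [g + U] is an admissible majorant of [G], and every admissible majorant
    of [G] dominates [g - U]. *)
Lemma outer_expectation_dist P (G g : T -> R) (U : T -> \bar R) (M : R) :
  measurable_fun [set: T] g -> (forall x, `|g x| <= M)%R ->
  measurable_fun [set: T] U -> (forall x, `|G x - g x|%:E <= U x) ->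
  `|outer_expectation P (fun x => (G x)%:E) - 'E_P[g]| <= \int[P]_x U x.
Proof.
move=> mg gM mU GU; rewrite unlock.
have U0 x : 0 <= U x by apply: le_trans (GU x); rewrite lee_fin.
have intU0 : 0 <= \int[P]_x U x by exact: integral_ge0.
have gi : P.-integrable [set: T] (fun x => (g x)%:E).
  exact: bounded_integrable mg gM.
have mgE : measurable_fun [set: T] (fun x => (g x)%:E) by exact/measurable_EFinP.
have [->|Uoo] := eqVneq (\int[P]_x U x) +oo; first exact: leey.
have Ui : P.-integrable [set: T] U.
  apply/integrableP; split=> //; under eq_integral do rewrite gee0_abs//.
  by rewrite ltey.
have up : outer_expectation P (fun x => (G x)%:E) <=
    \int[P]_x (g x)%:E + \int[P]_x U x.
  rewrite -integralD//; apply: ereal_inf_lbound; eexists; last reflexivity.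
  split; first exact: emeasurable_funD.
    by apply: integrable_integral_exists; exact: integrableD.
  move=> x; apply: le_trans (leeD (lexx (g x)%:E) (GU x)).
  by rewrite -EFinD lee_fin -lerBlDl ler_norm.
have lo : \int[P]_x (g x)%:E - \int[P]_x U x <=
    outer_expectation P (fun x => (G x)%:E).
  apply: le_ereal_inf_tmp => _ [V [mV _ GV] <-].
  rewrite -integralB//; apply: le_integral_measurable => //.
    exact: emeasurable_funB.
  move=> x; apply: le_trans (GV x).
  apply: le_trans (leeB (lexx (g x)%:E) (GU x)) _.
  by rewrite -EFinB lee_fin lerBlDr -lerBlDl distrC ler_norm.
have gfin : \int[P]_x (g x)%:E \is a fin_num by exact: integrable_fin_num.
have Ufin : \int[P]_x U x \is a fin_num by exact: integrable_fin_num.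
move: up lo; rewrite -(fineK gfin) -(fineK Ufin).
case: (outer_expectation _ _) => [z| |]//=; rewrite -?EFinD -?EFinB !lee_fin.
by move=> up lo; rewrite ler_norml; apply/andP; split; lra.
Qed.

Lemma outer_probability_le_measurable (mu : {measure set T -> \bar R}) A B :
  measurable B -> A `<=` B -> outer_probability mu A <= mu B.
Proof. by move=> mB AB; apply: ereal_inf_lbound; exists B. Qed.

Lemma outer_probability_ge0 (mu : {measure set T -> \bar R}) A :
  0 <= outer_probability mu A.
Proof. by apply: le_ereal_inf_tmp => _ [B [_ _] <-]; exact: measure_ge0. Qed.

Lemma markov_ge0 (mu : {measure set T -> \bar R}) (f : T -> \bar R) (e : R) :
  (0 < e)%R -> measurable_fun [set: T] f -> (forall x, 0 <= f x) ->
  mu [set x | e%:E < f x] <= e^-1%:E * \int[mu]_x f x.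
Proof.
move=> e0 mf f0; rewrite lee_pdivlMl//.
have := @le_integral_comp_abse _ _ _ mu setT measurableT f e id.
rewrite setTI => /(_ (@measurable_id _ _ _) (fun r => id) (fun x y _ _ => id) mf e0).
under eq_integral do rewrite gee0_abs//.
apply: le_trans; rewrite lee_pmul2l// le_measure// ?inE.
- by rewrite -[X in measurable X]setTI; exact: emeasurable_fun_o_infty.
- rewrite -[X in measurable X]setTI; apply: emeasurable_fun_c_infty => //.
  exact: measurableT_comp.
- by move=> x /= /ltW; rewrite gee0_abs.
Qed.

End outer_expectation_lemmas.

(** * Discretization error of the limit and comparison of conditional laws *)

Lemma tight_step_error (R : realType) (I : Type) d (T : measurableType d)
    (P : probability T R) (Z : T -> linf R I) (e : R) : 0 < e ->
  measurable_fun [set: T] (Z : T -> borel (linf R I)) -> tight P Z ->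
  exists l (t : 'I_l -> I) (k : I -> 'I_l),
    ('E_P[step_error t k \o Z] <= e%:E)%E.
Proof.
(* On [K] the error is at most [e / 2]; off [K] it is at most 2, with probability at most
   [e / 4]. *)
move=> e0 mZ tZ; have [|K cK PK] := tZ (e / 4); first by lra.
have [|l [t [k Ke]]] := @compact_step_error _ _ K (e / 2) _ cK; first by lra.
exists l, t, k; rewrite unlock.
have mK : measurable (~` (Z @^-1` K)).
  rewrite preimage_setC -[X in measurable X]setTI; apply: mZ => //.
  apply: sub_sigma_algebra; apply: closed_openC.
  exact: compact_closed (@norm_hausdorff _ _) cK.
have mh : measurable_fun [set: T] (step_error t k \o Z).
  by apply: continuous_borel_measurable => //; exact: step_error_continuous.
apply: (@le_trans _ _
    (\int[P]_x ((e / 2)%:E + 2%:E * (\1_(~` (Z @^-1` K)) x)%:E))%E).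
  apply: le_integral_measurable => [||x].
  - exact/measurable_EFinP.
  - by apply: emeasurable_funD => //; apply: emeasurable_funM => //; apply/measurable_EFinP.
  - rewrite -EFinM -EFinD lee_fin indicE; case: (boolP (_ \in _)).
      by move=> _; rewrite mulr1; have := step_error_le2 t k (Z x); rewrite /=; lra.
    by move=> /negP; rewrite inE /= => /contrapT/Ke; rewrite mulr0 addr0.
have i0 x : (0 <= (\1_(~` (Z @^-1` K)) x : R)%:E)%E by rewrite lee_fin.
have mi : measurable_fun [set: T] (fun x => (\1_(~` (Z @^-1` K)) x : R)%:E).
  exact/measurable_EFinP.
rewrite ge0_integralD//; [|by move=> x _; rewrite lee_fin; lra
  |by apply: emeasurable_funM].
rewrite integral_cst// ge0_integralZl// integral_indic// setIT.
rewrite [X in (_ * X + _)%E](_ : _ = 1%E) ?mule1; last exact: probability_setT.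
have : (P (~` (Z @^-1` K)) <= (e / 4)%:E)%E.
  have mZK : measurable (Z @^-1` K) by rewrite -[X in measurable X]setCK; exact: measurableC.
  rewrite probability_setC// leeBlDr ?fin_num_measure//.
  by apply: le_trans (leeD (lexx _) PK); rewrite -EFinD lee_fin; lra.
move=> PKC; apply: le_trans (leeD (lexx _) (lee_wpmul2l _ PKC)) _ => //.
by rewrite -EFinM -EFinD lee_fin; lra.
Qed.

(** Only [a] may be infinite: it stands for an outer expectation, the other terms for expectations
    of bounded measurable functions. *)
Lemma le_abse_chain (R : realType) (a : \bar R) (b c d : R) :
  (`|a - d%:E| <= `|a - b%:E| + `|b%:E - c%:E| + `|c%:E - d%:E|)%E.
Proof.
case: a => [a| |]; [|by []|by []].
rewrite -!EFinB -!EFinD lee_fin.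
rewrite (_ : a - d = a - b + (b - c) + (c - d)); last by rewrite !addrA !subrK.
by rewrite (le_trans (ler_normD _ _))// lerD2r ler_normD.
Qed.

(** The two entries of the minimum correspond to the two conditions in [BL1], boundedness and the
    Lipschitz property. *)
Lemma step_error_BL1 (R : realType) (I : Type) l (t : 'I_l -> I) (k : I -> 'I_l)
    (g : linf R I -> R) z :
  BL1 g -> `|g z - g (step k (sample t z))| <= step_error t k z.
Proof.
case=> g1 gL; rewrite le_min gL andbT.
apply: le_trans (ler_normB _ _) _.
by have := g1 z; have := g1 (step k (sample t z)); lra.
Qed.

(** This turns a test functional on bounded functions into one covered by the finite-dimensional
    distance. *)
Lemma BL1_step (R : realType) (I : Type) l (k : I -> 'I_l) (g : linf R I -> R) :
  BL1 g -> BL1 (g \o step k).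
Proof. case=> g1 gL; split=> [v|v w]; first exact: g1.
exact: le_trans (gL _ _) (le_norm_step k v w). Qed.

Lemma evaluation_continuous (R : realType) (I : Type) (i : I) :
  continuous (fun z : linf R I => z i).
Proof.
apply: (@lipschitz_continuous _ _ _ 1) => // x y; rewrite mul1r.
exact: (linf_norm_ub (x - y)).
Qed.

Section conditional.
Context (R : realType) (I : Type).
Context d1 (T1 : measurableType d1).
Context d2 (T2 : measurableType d2) (P2 : probability T2 R).
Context d (T : measurableType d) (P : probability T R).
Variables (Y : T1 * T2 -> linf R I) (Z : T -> linf R I).
Variables (l : nat) (t : 'I_l -> I) (k : I -> 'I_l).
Hypothesis mY : forall i, measurable_fun [set: T1 * T2] (fun w => Y w (t i)).
Hypothesis mZ : measurable_fun [set: T] (Z : T -> borel (linf R I)).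

Lemma sample_measurable d' (S : measurableType d') (X : S -> linf R I) :
  (forall i, measurable_fun [set: S] (fun w => X w (t i))) ->
  forall i, measurable_fun [set: S] (fun w => sample t (X w) 0 i).
Proof. by move=> mX i; under eq_fun do rewrite mxE; exact: mX. Qed.

Lemma measurable_evaluation i : measurable_fun [set: T] (fun w => Z w i).
Proof. exact: continuous_borel_measurable mZ (@evaluation_continuous _ _ i). Qed.

Local Open Scope ereal_scope.

(** A chain through [g o step k] at the samples of [Y] and of [Z]. Only evaluations of [Y] are known
    to be measurable, so its discretization error is controlled by sections of a jointly measurable
    majorant; [Z] is Borel, so its error has an ordinary expectation. *)
Lemma conditional_BL1_distance_le (U : T1 * T2 -> \bar R) w :
  measurable_fun [set: T1 * T2] U ->
  (forall w', (step_error t k (Y w'))%:E <= U w') ->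
  BL1_distance
    (fun g : linf R I -> R =>
       outer_expectation P2 (fun w' => (g (Y (w, w')))%:E))
    (fun g : linf R I -> R => 'E_P[g \o Z]) <=
  \int[P2]_w' U (w, w') +
  BL1_distance
    (fun g : 'rV[R]_l -> R => 'E_P2[fun w' => g (sample t (Y (w, w')))])
    (fun g : 'rV[R]_l -> R => 'E_P[fun w' => g (sample t (Z w'))]) +
  'E_P[step_error t k \o Z].
Proof.
move=> mU YU; apply: ge_ereal_sup => _ [g bg <-].
have mY2 i : measurable_fun [set: T2] (fun w' => Y (w, w') (t i)).
  exact: measurableT_comp (mY i) (pair1_measurable w).
have mZt i : measurable_fun [set: T] (fun w' => Z w' (t i)).
  exact: measurable_evaluation.
have bgs := BL1_step k bg.
have [bg1 _] := bg; have [bgs1 _] := bgs.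
have fY := BL1_expectation_fin_num P2 bgs (sample_measurable mY2).
have fZ := BL1_expectation_fin_num P bgs (sample_measurable mZt).
have mgZ : measurable_fun [set: T] (g \o Z).
  by apply: continuous_borel_measurable => //; exact: BL1_continuous.
have gZi : P.-integrable [set: T] (fun x => ((g \o Z) x)%:E).
  by apply: (@bounded_integrable _ _ _ _ _ 1) => // x; exact: bg1.
have mgsZ := BL1_measurable bgs (sample_measurable mZt).
have gsZi : P.-integrable [set: T] (fun x => ((g \o step k) (sample t (Z x)))%:E).
  by apply: (@bounded_integrable _ _ _ _ _ 1) => // x; exact: bgs1.
have fgZ : 'E_P[g \o Z] \is a fin_num by rewrite unlock; exact: integrable_fin_num.
have := le_abse_chain (outer_expectation P2 (fun w' => (g (Y (w, w')))%:E))
  (fine 'E_P2[fun w' => (g \o step k) (sample t (Y (w, w')))])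
  (fine 'E_P[fun w' => (g \o step k) (sample t (Z w'))]) (fine 'E_P[g \o Z]).
rewrite !fineK// => /le_trans; apply; apply: leeD; first apply: leeD.
- apply: (@outer_expectation_dist _ _ _ _ _ _ _ 1).
  + exact: BL1_measurable (sample_measurable mY2).
  + by move=> x; exact: bgs1.
  + exact: measurableT_comp mU (pair1_measurable w).
  + move=> w'; apply: le_trans (YU _); rewrite lee_fin; exact: step_error_BL1.
- by apply: ereal_sup_ubound; exists (g \o step k).
- rewrite unlock -integralB//; apply: le_trans (le_abse_integral _ _ _) _ => //.
    by apply: emeasurable_funB; apply/measurable_EFinP.
  apply: ge0_le_integral => //.
  + apply: measurableT_comp => //.
    by apply: emeasurable_funB; apply/measurable_EFinP.
  + apply/measurable_EFinP; apply: continuous_borel_measurable => //.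
    exact: step_error_continuous.
  + by move=> x _; rewrite -EFinB lee_fin distrC; exact: step_error_BL1.
Qed.

End conditional.

(** * Joint measurability of the multiplier process and conditional convergence *)

Lemma cvge0_near (R : realType) (u : nat -> \bar R) :
  (forall n, (0 <= u n)%E) ->
  (forall e : R, 0 < e -> \forall n \near \oo, (u n <= e%:E)%E) ->
  u @ \oo --> 0%E.
Proof.
move=> u0 ue.
have ufin n (e : R) : (u n <= e%:E)%E -> u n \is a fin_num.
  by move=> une; rewrite ge0_fin_numE// (le_lt_trans une) ?ltry.
apply/fine_cvgP; split; first by have := ue _ ltr01; apply: filterS => n; exact: ufin.
apply/cvgrPdist_le => e e0; apply: filterS (ue _ e0) => n une.
by rewrite sub0r normrN ger0_norm ?fine_ge0//= -lee_fin fineK// (ufin _ e).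
Qed.

Lemma multiplier_process_measurable (R : realType) (d : nat)
    dX (OX : measurableType dX) (PX : probability OX R)
    (X : nat -> nat -> OX -> 'rV[R]_d) (r : nat -> nat)
    dxi (Oxi : measurableType dxi) (xi : nat -> Oxi -> R) n (f : Ecup R d -> R) :
  (forall j, measurable_fun [set: Oxi] (xi j)) ->
  (forall j, (j < n %/ r n)%N -> measurable_fun [set: OX] (f \o clusterY X r n j)) ->
  measurable_fun [set: OX * Oxi] (fun w => multiplier_process PX X r xi n w f).
Proof.
move=> mxi mf; apply: measurable_funM => //; apply: measurable_sum => j.
apply: measurable_funM; first exact: measurableT_comp (mxi j) measurable_snd.
apply: measurable_funB => //.
exact: measurableT_comp (mf j (ltn_ord j)) measurable_fst.
Qed.

Theorem theorem2p3 (R : realType) (d : nat)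
  (F : set (Ecup R d -> R)) (hF : F `<=` @cluster_functional R d)
  (dX : measure_display) (OX : measurableType dX) (PX : probability OX R)
  (X : nat -> nat -> OX -> 'rV[R]_d)
  (hX : forall n i, (i < n)%N ->
    measurable_fun [set: OX] (X n i : OX -> borel 'rV[R]_d))
  (hstat : rowwise_stationary PX X)
  (hv : forall n, (0 < n)%N -> 0 < nonzero_prob PX X n)
  (r : nat -> nat) (hr : forall n, (0 < n)%N -> (0 < r n)%N)
  (hint : forall (f : F) n j, (j < n %/ r n)%N ->
    PX.-integrable [set: OX] (fun w => (\val f (clusterY X r n j w))%:E))
  (dxi : measure_display) (Oxi : measurableType dxi) (Pxi : probability Oxi R)
  (xi : nat -> {RV Pxi >-> R})
  (hindep : mutually_independent Pxi (fun j => xi j : Oxi -> R))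
  (hid : identically_distributed Pxi (fun j => xi j : Oxi -> R))
  (hmean : forall j, 'E_Pxi[xi j]%E = 0%E)
  (hvar : forall j, 'V_Pxi[xi j]%E = 1%E)
  (Zn : nat -> OX * Oxi -> linf R F)
  (hZn : forall n w (f : F),
    Zn n w f = multiplier_process PX X r (fun j => xi j : Oxi -> R) n w (\val f))
  (c : F -> F -> R)
  (hc : forall f g : F,
    (fun n => (((r n)%:R * nonzero_prob PX X n)^-1)%:E *
      covariance PX (\val f \o clusterY X r n 0) (\val g \o clusterY X r n 0))%E
    @ \oo --> (c f g)%:E)
  (dZ : measure_display) (OZ : measurableType dZ) (PZ : probability OZ R)
  (Z : OZ -> linf R F)
  (hZ : centered_gaussian_process PZ (fun (f : F) w => Z w f) c)
  (hrho : exists rho : F -> F -> R,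
    [/\ semimetric rho, totally_bounded_for rho &
      (fun delta : R => limn_esup (fun n =>
        ereal_sup [set ((((r n)%:R * nonzero_prob PX X n)^-1)%:E *
          'E_PX[fun w => ((\val fg.1 (clusterY X r n 0 w) -
                           \val fg.2 (clusterY X r n 0 w)) ^+ 2)%R])%E
          | fg in [set fg : F * F | rho fg.1 fg.2 < delta]]))
      @ 0^'+ --> 0%E])
  (hfidi : forall (l : nat) (fs : 'I_l -> F) (eps : R), 0 < eps ->
    (fun n => PX [set w | (eps%:E < BL1_distance
        (fun g : 'rV[R]_l -> R =>
           'E_Pxi[fun w' => g (\row_k Zn n (w, w') (fs k))])
        (fun g : 'rV[R]_l -> R =>
           'E_PZ[fun w' => g (\row_k Z w' (fs k))]))%E])
    @ \oo --> 0%E)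
  (hweak : cvg_weakly (PX \x Pxi)%E Zn PZ Z)
  (eps : R) (heps : 0 < eps) :
  (fun n => outer_probability PX [set w | (eps%:E < BL1_distance
      (fun g : linf R F -> R =>
         outer_expectation Pxi (fun w' => (g (Zn n (w, w')))%:E))
      (fun g : linf R F -> R => 'E_PZ[g \o Z]))%E])
  @ \oo --> 0%E.
Proof.
have [mZ tZ W] := hweak.
have mZn n f : measurable_fun [set: OX * Oxi] (fun w => Zn n w f).
  under eq_fun do rewrite hZn.
  apply: multiplier_process_measurable => // j jn.
  (* Measurability of the block functionals is read off from their integrability. *)
  by apply/measurable_EFinP; have /integrableP[] := hint f n j jn.
apply: cvge0_near => [n|kap kap0]; first exact: outer_probability_ge0.
(* The first bound makes the error of [Z] at most [eps / 3]; the second gives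
   [(3 / eps) * (2 * eta) <= kap / 2] in Markov's inequality. *)
pose eta := Num.min (eps / 3) (kap * eps / 12).
have eta0 : 0 < eta by rewrite lt_min; apply/andP; split; [lra|rewrite divr_gt0// mulr_gt0].
have eta1 : eta <= eps / 3 by rewrite ge_min lexx.
have eta2 : eta <= kap * eps / 12 by rewrite ge_min lexx orbT.
have eps3 : 0 < eps / 3 by lra.
have [l [t [k hk]]] := tight_step_error eta0 mZ tZ.
have Wn := W _ (@step_error_continuous _ _ _ t k).
have {}Wn : (fun n => outer_expectation (PX \x Pxi)%E
    (fun w => (step_error t k (Zn n w))%:E)) @ \oo --> 'E_PZ[step_error t k \o Z]%E.
  by apply: Wn; exists 2 => z; rewrite ger0_norm ?step_error_ge0// step_error_le2.
(* The slack from [eta] to [2 * eta] gives a strict bound on the limit, inherited by the outer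
   expectations for large [n]. *)
have hk2 : ('E_PZ[step_error t k \o Z] < (2 * eta)%:E)%E.
  by apply: le_lt_trans hk _; rewrite lte_fin; lra.
have kap2 : (0%E < (kap / 2)%:E)%E by rewrite lte_fin; lra.
pose D n w := BL1_distance
  (fun g : 'rV[R]_l -> R => 'E_Pxi[fun w' => g (sample t (Zn n (w, w')))]%E)
  (fun g : 'rV[R]_l -> R => 'E_PZ[fun w' => g (sample t (Z w'))]%E).
have Dn : \forall n \near \oo,
    (PX [set w | ((eps / 3)%:E < D n w)%E] < (kap / 2)%:E)%E.
  exact: hfidi l t _ eps3 _ (open_ereal_lt' kap2).
near=> n.
have : (outer_expectation (PX \x Pxi) (fun w => (step_error t k (Zn n w))%:E) <
    (2 * eta)%:E)%E.
  by near: n; exact: Wn (open_ereal_lt' hk2).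
move=> /ereal_inf_lt[_ [U [mU _ hU] <-] Ueta].
have U0 w : (0 <= U w)%E by apply: le_trans (hU w); rewrite lee_fin step_error_ge0.
have mD : measurable [set w | ((eps / 3)%:E < D n w)%E].
  apply: (BL1_distance_gt_measurable PX Pxi PZ (a := fun w => sample t (Zn n w))
    (b := fun w => sample t (Z w))).
    by apply: sample_measurable => i; exact: mZn.
  by apply: sample_measurable => i; exact: measurable_evaluation.
have PD : (PX [set w | ((eps / 3)%:E < D n w)%E] < (kap / 2)%:E)%E.
  by near: n.
(* By Tonelli, the conditional integral of [U] is measurable in the data and has mean below
   [2 * eta]. *)
have mF := measurable_fun_fubini_tonelli_F (m2 := Pxi) U mU U0.
have mFs : measurable [set w | ((eps / 3)%:E < fubini_F Pxi U w)%E].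
  by rewrite -[X in measurable X]setTI; exact: emeasurable_fun_o_infty.
have PF : (PX [set w | ((eps / 3)%:E < fubini_F Pxi U w)%E] <= (kap / 2)%:E)%E.
  apply: le_trans (markov_ge0 _ eps3 mF _) _.
    by move=> w; exact: integral_ge0.
  rewrite -fubini_tonelli1// lee_pdivrMl//; apply: le_trans (ltW Ueta) _.
  by rewrite -EFinM lee_fin; lra.
(* Two measurable exceptional events, of probability at most [kap / 2] each, cover the event in
   question: outside them all three terms of the distance bound are at most [eps / 3]. *)
apply: (@le_trans _ _ (PX ([set w | ((eps / 3)%:E < fubini_F Pxi U w)%E] `|`
    [set w | ((eps / 3)%:E < D n w)%E]))); last first.
  apply: le_trans (measureU2 _ mFs mD) _; apply: le_trans (leeD PF (ltW PD)) _.
  by rewrite -EFinD lee_fin; lra.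
apply: outer_probability_le_measurable; first exact: measurableU.
move=> w /= epsw.
have [?|Fw] := ltP (eps / 3)%:E (fubini_F Pxi U w); first by left.
have [?|Dw] := ltP (eps / 3)%:E (D n w); first by right.
exfalso; move: epsw; apply/negP; rewrite -leNgt.
have := conditional_BL1_distance_le Pxi PZ (fun i => mZn n (t i)) mZ w mU hU.
move=> /le_trans; apply.
apply: le_trans (leeD (leeD Fw Dw) hk) _.
by rewrite -!EFinD lee_fin; lra.
Unshelve. all: by end_near. Qed.
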